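(* (Truthful-Bidding Incentive Compatibility) In the joint electricity-carbon market defined in the context, it is optimal for price-taking agents to bid their true cost functions and true operational parameters. That is: (i) for each generator $i\in\mathcal{I}$ with true parameters $\theta^*=(c_i,e_i,\overline{P}_i)$, the bid $\theta=\theta^*$ is an optimal solution of $$\max_\theta\ -(c_i+\delta\kappa e_i)\,p_i^*(\theta)+\lambda_i^{\rm pro}\,p_i^*(\theta)\quad\text{s.t. } 0\le p_i^*(\theta)\le\overline{P}_i;$$ (ii) for each load $j\in\mathcal{J}$ with true parameters $\theta^*=(b_j,\overline{D}_j)$, the bid $\theta=\theta^*$ is an optimal solution of $$\max_\theta\ b_j\,d_j^*(\theta)-\lambda_j^{\rm pro}\,d_j^*(\theta)\quad\text{s.t. } 0\le d_j^*(\theta)\le\overline{D}_j.$$ Here $c_i,e_i,\overline{P}_i,b_j,\overline{D}_j$ in the objectives and constraints are the true values, and $\lambda_i^{\rm pro},\lambda_j^{\rm pro},\delta$ are treated as given constants not depending on $\theta$.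
   Context: Data: finite sets $\mathcal{I}$ (generators), $\mathcal{J}$ (loads), $\mathcal{L}$ (lines); real marginal generation costs $c_i$, emission factors $e_i\ge 0$, maximum productions $\overline{P}_i\ge 0$ ($i\in\mathcal{I}$); real marginal utilities $b_j$, maximum consumptions $\overline{D}_j\ge 0$ ($j\in\mathcal{J}$); line capacities $F_l\ge 0$ and real node-to-line transfer factors $\pi_{il},\pi_{jl}$ ($l\in\mathcal{L}$); a coefficient $\kappa\ge0$ converting emissions into money; a parameter $\delta\in[0,1]$. Carbon-aware social welfare maximization (SW): $$O^*=\max_{p,d}\ \sum_{j}b_jd_j-\sum_i(c_i+\kappa e_i)p_i$$ subject to $\sum_i p_i=\sum_j d_j$; $0\le p_i\le\overline{P}_i$ for all $i$; $0\le d_j\le\overline{D}_j$ for all $j$; $-F_l\le\sum_i\pi_{il}p_i-\sum_j\pi_{jl}d_j\le F_l$ for all $l$. Its optimal dispatch is denoted $(p^*,d^* )$; it is assumed unique. Market-clearing problem (MC$_\delta$), in variables $p,d,\lambda,\underline\mu,\overline\mu,\underline\phi,\overline\phi,\underline\chi,\overline\chi$: $$\max\ \sum_j b_jd_j-\sum_i(c_i+\delta\kappa e_i)p_i$$ subject to (a) $\sum_ip_i=\sum_jd_j$ [multiplier $\tau\in\mathbb{R}$]; (b) $0\le p_i\le\overline{P}_i$ for all $i$; (c) $0\le d_j\le\overline{D}_j$ for all $j$; (d) $-F_l\le\sum_i\pi_{il}p_i-\sum_j\pi_{jl}d_j\le F_l$ for all $l$ [multipliers $\underline\alpha_l\ge0$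 for the lower inequality, $\overline\alpha_l\ge0$ for the upper inequality]; (e) $-\lambda-\underline\mu_i+\overline\mu_i-\sum_l\pi_{il}(\overline\chi_l-\underline\chi_l)=-(c_i+\kappa e_i)$ for all $i$; (f) $\lambda-\underline\phi_j+\overline\phi_j+\sum_l\pi_{jl}(\overline\chi_l-\underline\chi_l)=b_j$ for all $j$; (g) $\underline\mu,\overline\mu,\underline\phi,\overline\phi,\underline\chi,\overline\chi\ge0$; (h) $\sum_i\overline\mu_i\overline{P}_i+\sum_j\overline\phi_j\overline{D}_j+\sum_l(\overline\chi_l+\underline\chi_l)F_l\le\sum_jb_jd_j-\sum_i(c_i+\kappa e_i)p_i$ [multiplier $\eta\ge0$]. Lagrangian dual: minimize over $\tau\in\mathbb{R}$, $\underline\alpha,\overline\alpha\ge0$, $\eta\ge0$ the maximum of $\mathscr{L}$ over $(p,d)$ satisfying (b),(c) and $(\lambda,\underline\mu,\overline\mu,\underline\phi,\overline\phi,\underline\chi,\overline\chi)$ satisfying (e)-(g), where $$\begin{aligned}\mathscr{L}=&\sum_jb_jd_j-\sum_i(c_i+\delta\kappa e_i)p_i+\tau\Big(\sum_ip_i-\sum_jd_j\Big)\\&+\sum_l\underline\alpha_l\Big(F_l+\sum_i\pi_{il}p_i-\sum_j\pi_{jl}d_j\Big)+\sum_l\overline\alpha_l\Big(F_l-\sum_i\pi_{il}p_i+\sum_j\pi_{jl}d_j\Big)\\&+\eta\Big(-\sum_i\overline\mu_i\overline{P}_i-\sum_j\overline\phi_j\overline{D}_j-\sum_l(\overline\chi_l+\underline\chi_l)F_l+\sum_jb_jd_j-\sum_i(c_i+\kappa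 e_i)p_i\Big).\end{aligned}$$ $(\tau^*,\underline\alpha^*,\overline\alpha^*,\eta^* )$ denotes an optimal solution of this dual; if the optimal $\eta$ is not unique, $\eta^*$ is taken to be the smallest one among all dual optimal solutions. Prices: generator $i$ is paid $\lambda_i^{\rm pro}=\tau^*+\sum_l(\underline\alpha_l^*-\overline\alpha_l^* )\pi_{il}-\eta^*(c_i+\kappa e_i)$ per unit and pays a carbon tax at rate $\delta\kappa$ (i.e. $\delta\kappa e_ip_i$); load $j$ pays $\lambda_j^{\rm pro}=\tau^*+\sum_l(\underline\alpha_l^*-\overline\alpha_l^* )\pi_{jl}-\eta^*b_j$ per unit. Bidding: an agent (generator or load) submits a bid $\theta$ for its own parameters; $\theta^*$ denotes their true values. For a generator $i$, $\theta=(c_i',e_i',\overline{P}_i')$ with $\overline{P}_i'\ge 0$; for a load $j$, $\theta=(b_j',\overline{D}_j')$ with $\overline{D}_j'\ge0$. $p_i^*(\theta)$ (resp. $d_j^*(\theta)$) is the agent's own component of the optimal solution of (SW) when the agent's parameters in (SW) are replaced by $\theta$ and all other data are kept fixed; thus $p_i^*(\theta^* )=p_i^*$ and $d_j^*(\theta^* )=d_j^*$. If for some $\theta$ that optimal solution is not unique, any fixed choice of optimal solution may be used. An agent is price-taking if it regards its price $\lambda^{\rm pro}$ as a given constant not affected by its bid; this constant is $\lambda_i^{\rm pro}=\tau^*+\sum_l(\underline\alpha_l^*-\overline\alpha_l^* )\pi_{il}-\eta^*(c_i+\kappa e_i)$ for a generator $i$ and $\lambda_j^{\rm pro}=\tau^*+\sum_l(\underline\alpha_l^*-\overline\alpha_l^*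 )\pi_{jl}-\eta^*b_j$ for a load $j$, where $c_i,e_i,b_j$ are the true values and $(\tau^*,\underline\alpha^*,\overline\alpha^*,\eta^* )$ is the optimal solution of the Lagrangian dual of (MC$_\delta$) formed with the true data of all agents. *)

(* Defs.v *)
From HB Require Import structures.
From mathcomp Require Import all_boot all_order all_algebra.
From mathcomp Require Import all_classical all_reals ereal.

Set Implicit Arguments.
Unset Strict Implicit.
Unset Printing Implicit Defensive.
Import Order.TTheory GRing.Theory Num.Theory.
Local Open Scope ring_scope.

(** [x] is an optimal solution of [max obj t  s.t.  feas t]. *)
Definition is_maximizer (R : realType) (T : Type) (feas : T -> Prop)
    (obj : T -> R) (x : T) : Prop :=
  feas x /\ forall t, feas t -> obj t <= obj x.

(** Raw data of the market; no sign condition is built in, since the data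
    obtained from a bid need not satisfy those of the true data. *)
Record market (R : realType) (I J L : finType) := Market {
  cost : I -> R;             (* c_i *)
  emission : I -> R;         (* e_i *)
  pmax : I -> R;
  utility : J -> R;          (* b_j *)
  dmax : J -> R;
  capacity : L -> R;         (* F_l *)
  gen_ptdf : I -> L -> R;    (* pi_il *)
  load_ptdf : J -> L -> R;   (* pi_jl *)
  kappa : R }.

Definition valid_market (R : realType) (I J L : finType)
    (M : market R I J L) : Prop :=
  [/\ forall i, 0 <= emission M i, forall i, 0 <= pmax M i,
      forall j, 0 <= dmax M j, forall l, 0 <= capacity M l & 0 <= kappa M].

Record dispatch (R : realType) (I J : finType) := Dispatch {
  production : {ffun I -> R};      (* p *)
  consumption : {ffun J -> R} }.    (* d *)

Section Problems.
Context (R : realType) (I J L : finType) (M : market R I J L).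
Implicit Type x : dispatch R I J.

Definition imbalance x : R := \sum_i production x i - \sum_j consumption x j.

Definition flow x (l : L) : R :=
  \sum_i gen_ptdf M i l * production x i
  - \sum_j load_ptdf M j l * consumption x j.

Definition in_box x : Prop :=
  (forall i, 0 <= production x i <= pmax M i) /\
  (forall j, 0 <= consumption x j <= dmax M j).

Definition in_network x : Prop :=
  imbalance x = 0 /\ forall l, - capacity M l <= flow x l <= capacity M l.

(** Welfare when a fraction [r] of the emission cost is counted: [welfare 1] is
    maximized by the carbon-aware social welfare problem, [welfare delta] by
    the market-clearing problem. *)
Definition welfare (r : R) x : R :=
  \sum_j utility M j * consumption x j
  - \sum_i (cost M i + r * kappa M * emission M i) * production x i.

Definition sw_feasible x : Prop := in_box x /\ in_network x.

Definition sw_optimal x : Prop := is_maximizer sw_feasible (welfare 1) x.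

(** Variables of the linear-programming dual of the social welfare problem; the
    market-clearing problem optimizes over them together with the dispatch. *)
Record sw_dual := SwDual {
  lambda : R;
  mu_lo : {ffun I -> R};  mu_up : {ffun I -> R};
  phi_lo : {ffun J -> R}; phi_up : {ffun J -> R};
  chi_lo : {ffun L -> R}; chi_up : {ffun L -> R} }.

Definition sw_dual_feasible (z : sw_dual) : Prop :=
  [/\ forall i, - lambda z - mu_lo z i + mu_up z i
                - \sum_l gen_ptdf M i l * (chi_up z l - chi_lo z l)
                = - (cost M i + kappa M * emission M i),
      forall j, lambda z - phi_lo z j + phi_up z j
                + \sum_l load_ptdf M j l * (chi_up z l - chi_lo z l)
                = utility M j
    & [/\ forall i, 0 <= mu_lo z i /\ 0 <= mu_up z i,
          forall j, 0 <= phi_lo z j /\ 0 <= phi_up z j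
        & forall l, 0 <= chi_lo z l /\ 0 <= chi_up z l]].

Definition sw_dual_value (z : sw_dual) : R :=
  \sum_i mu_up z i * pmax M i + \sum_j phi_up z j * dmax M j
  + \sum_l (chi_up z l + chi_lo z l) * capacity M l.

(** The market-clearing problem is to maximize [welfare delta x] over
    [mc_feasible x z]. By weak duality its last constraint, the absence of a
    duality gap, forces [x] to be [sw_optimal]. *)
Definition mc_feasible x (z : sw_dual) : Prop :=
  [/\ in_box x, in_network x, sw_dual_feasible z
    & sw_dual_value z <= welfare 1 x].

(** Multipliers of the constraints of the market-clearing problem that are
    relaxed: the power balance, the lower and upper line limits, and the
    absence of a duality gap. *)
Record multipliers := Multipliers {
  tau : R;
  alpha_lo : {ffun L -> R};
  alpha_up : {ffun L -> R};
  eta : R }.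

Definition multipliers_feasible (y : multipliers) : Prop :=
  [/\ forall l, 0 <= alpha_lo y l, forall l, 0 <= alpha_up y l & 0 <= eta y].

Definition lagrangian (delta : R) (y : multipliers) x (z : sw_dual) : R :=
  welfare delta x + tau y * imbalance x
  + \sum_l alpha_lo y l * (capacity M l + flow x l)
  + \sum_l alpha_up y l * (capacity M l - flow x l)
  + eta y * (welfare 1 x - sw_dual_value z).

(** The inner maximization of the Lagrangian dual; its value is [+oo] when the
    Lagrangian is unbounded above. *)
Definition dual_function (delta : R) (y : multipliers) : \bar R :=
  ereal_sup [set v : \bar R | exists x z,
    [/\ in_box x, sw_dual_feasible z & v = (lagrangian delta y x z)%:E]].

Definition dual_optimal (delta : R) (y : multipliers) : Prop :=
  multipliers_feasible y /\
  forall y', multipliers_feasible y' ->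
    (dual_function delta y <= dual_function delta y')%E.

Definition pricing_multipliers (delta : R) (y : multipliers) : Prop :=
  dual_optimal delta y /\
  forall y', dual_optimal delta y' -> eta y <= eta y'.

Definition gen_price (y : multipliers) (i : I) : R :=
  tau y + \sum_l (alpha_lo y l - alpha_up y l) * gen_ptdf M i l
  - eta y * (cost M i + kappa M * emission M i).

Definition load_price (y : multipliers) (j : J) : R :=
  tau y + \sum_l (alpha_lo y l - alpha_up y l) * load_ptdf M j l
  - eta y * utility M j.

End Problems.

Record gen_bid (R : realType) := GenBid {
  bid_cost : R; bid_emission : R; bid_pmax : R }.

Record load_bid (R : realType) := LoadBid { bid_utility : R; bid_dmax : R }.

Section Bids.
Context (R : realType) (I J L : finType) (M : market R I J L).

Definition true_gen_bid (i : I) : gen_bid R :=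
  GenBid (cost M i) (emission M i) (pmax M i).

Definition true_load_bid (j : J) : load_bid R :=
  LoadBid (utility M j) (dmax M j).

Definition set_gen_bid (i : I) (t : gen_bid R) : market R I J L :=
  Market [eta cost M with i |-> bid_cost t]
    [eta emission M with i |-> bid_emission t]
    [eta pmax M with i |-> bid_pmax t]
    (utility M) (dmax M) (capacity M) (gen_ptdf M) (load_ptdf M) (kappa M).

Definition set_load_bid (j : J) (t : load_bid R) : market R I J L :=
  Market (cost M) (emission M) (pmax M)
    [eta utility M with j |-> bid_utility t]
    [eta dmax M with j |-> bid_dmax t]
    (capacity M) (gen_ptdf M) (load_ptdf M) (kappa M).

(** [X t] is a fixed choice, for each bid [t] of generator [i], of an optimal
    social welfare dispatch under that bid: [production (X t) i] is
    p_i^*(t). *)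
Definition gen_response (i : I) (X : gen_bid R -> dispatch R I J) : Prop :=
  forall t, 0 <= bid_pmax t -> sw_optimal (set_gen_bid i t) (X t).

Definition load_response (j : J) (X : load_bid R -> dispatch R I J) : Prop :=
  forall t, 0 <= bid_dmax t -> sw_optimal (set_load_bid j t) (X t).

(** The profit and the payoff of price-taking agents: the prices are those of
    the true data [M], whatever the bid is. *)
Definition gen_profit (delta : R) (y : multipliers R L) (i : I)
    (q : R) : R :=
  - (cost M i + delta * kappa M * emission M i) * q + gen_price M y i * q.

Definition load_payoff (y : multipliers R L) (j : J) (q : R) : R :=
  utility M j * q - load_price M y j * q.

End Bids.

(* Main.v *)
Require Import Defs.
From mathcomp Require Import all_boot all_order all_algebra.
From mathcomp Require Import all_classical all_reals ereal.
From mathcomp Require Import ring lra.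
Import Order.TTheory GRing.Theory Num.Theory.
Local Open Scope ring_scope.

Set Implicit Arguments.
Unset Strict Implicit.
Unset Printing Implicit Defensive.

(** The Lagrangian of the market-clearing problem separates over the agents:
    up to a term free of the dispatch it is the sum of the profits and payoffs
    of the agents at the prices defined by the multipliers ([lagrangianE]).
    Hence, if the optimal dispatch [x] of the social welfare problem maximizes
    the Lagrangian over the box, each agent's share of [x] is its best quantity
    at its price.  A truthful bid yields exactly [x], and any admissible bid
    yields a quantity that the agent could have chosen within its true bounds,
    so truth-telling is optimal.

    That [x] maximizes the Lagrangian is strong duality for the market-clearing
    problem, whose two halves are affine instances of Farkas' lemma on the space
    of dispatches ([slack_certificate]).

    - No dispatch that satisfies the box and network constraints has a larger
      [welfare 1] than [x].  The certificate of this implication is a dual solution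
      [z] without duality gap ([sw_dual_attained]); so [(x, z)] is feasible for
      market clearing, and its Lagrangian is at least [welfare delta x].
    - By uniqueness, [x] is the only dispatch that satisfies the box and network
      constraints and has [welfare 1] at least that of [x]; so it maximizes
      [welfare delta] among them.  The certificate of that implication consists
      of multipliers, the one of the welfare constraint being [eta]; by weak
      duality their dual function is at most [welfare delta x]
      ([lagrangian_bound_attained]).

    The pricing multipliers minimize the dual function, so theirs is also at
    most [welfare delta x], which [(x, z)] reaches ([lagrangian_maximizer]). *)

(** * Farkas' lemma for linear forms on an arbitrary vector space *)

Section Farkas.
Variable R : realFieldType.

Lemma scalar_homogeneous (E : lmodType R) (f : E -> R) :
  scalar f -> forall a u, f (a *: u) = a * f u.
Proof.
move=> linf a u; have f0 : f 0 = 0 by move: (linf (-1) 0 0); rewrite scaler0 addr0; lra.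
by rewrite -[a *: u]addr0 linf f0 addr0.
Qed.

(** Induction on the number of forms, following Bartl.  If the other forms do
    not already force [g] to be nonnegative, some [x0] satisfies their
    constraints with [g x0 < 0], hence [f h x0 < 0] for the first form [f h];
    projecting the space onto the kernel of
    [f h] along [x0] eliminates [f h], and the sign conditions at [x0] make the
    multiplier recovered for [f h] nonnegative. *)
Lemma farkas (E : lmodType R) (K : eqType) (r : seq K)
    (f : K -> E -> R) (g : E -> R) :
  uniq r -> (forall k, scalar (f k)) -> scalar g ->
  (forall x, (forall k, k \in r -> 0 <= f k x) -> 0 <= g x) ->
  exists y : K -> R,
    (forall k, 0 <= y k) /\ forall x, g x = \sum_(k <- r) y k * f k x.
Proof.
elim: r f g => [|h r IHr] f g.
  move=> _ _ ling g_ge0; exists (fun=> 0); split=> // x.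
  have gx := g_ge0 x (fun k => ltac:(by rewrite in_nil)).
  have := g_ge0 ((-1) *: x) (fun k => ltac:(by rewrite in_nil)).
  by rewrite scalar_homogeneous// big_nil; lra.
rewrite cons_uniq => /andP[hNr uniqr] linf ling g_ge0.
have sum_ext (y : K -> R) c (F : K -> R) : \sum_(k <- r) y k * F k =
    \sum_(k <- r) (if k == h then c else y k) * F k.
  apply: eq_big_seq => k kr; case: eqP => // kh; by rewrite -kh kr in hNr.
have [g_ge0r|] := pselect (forall x, (forall k, k \in r -> 0 <= f k x) -> 0 <= g x).
  have [y [y_ge0 gE]] := IHr f g uniqr linf ling g_ge0r.
  exists (fun k => if k == h then 0 else y k); split=> [k|x].
    by case: ifP.
  by rewrite big_cons eqxx mul0r add0r -sum_ext gE.
move=> /existsNP[x0 /not_implyP[fx0 /negP]]; rewrite -ltNge => gx0.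
have fhx0 : f h x0 < 0.
  rewrite ltNge; apply/negP => fhx0; move: gx0; rewrite ltNge g_ge0// => k.
  by rewrite inE => /predU1P[->|/fx0].
(* The multiple of [x0] at which [f h] is [-1], so that [P] is a projection. *)
pose x1 := (- (f h x0)^-1) *: x0.
have fhx1 : f h x1 = -1 by rewrite scalar_homogeneous// mulNr mulVf// lt_eqF.
have inv_ge0 : 0 <= - (f h x0)^-1 by rewrite oppr_ge0 invr_le0 ltW.
have fx1 k : k \in r -> 0 <= f k x1.
  by move=> kr; rewrite scalar_homogeneous// mulr_ge0// fx0.
have gx1 : g x1 <= 0 by rewrite scalar_homogeneous// mulr_ge0_le0// ltW.
pose P x := f h x *: x1 + x.
have linP u : scalar u -> scalar (u \o P).
  by move=> linu a v w; rewrite /= /P !linu linf; ring.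
have [k|x fPx|y [y_ge0 gPE]] :=
  IHr (fun k => f k \o P) (g \o P) uniqr _ (linP _ ling).
- exact: linP.
- apply: g_ge0 => k; rewrite inE => /predU1P[->|/fPx//].
  by rewrite /P linf fhx1; lra.
pose c := \sum_(k <- r) y k * f k x1 - g x1.
exists (fun k => if k == h then c else y k); split=> [k|x].
  case: eqP => // _; rewrite subr_ge0 (le_trans gx1)// big_seq sumr_ge0// => j jr.
  by rewrite mulr_ge0// fx1.
rewrite big_cons eqxx -sum_ext.
have : g (P x) = f h x * (\sum_(k <- r) y k * f k x1) + \sum_(k <- r) y k * f k x.
  rewrite [LHS]gPE mulr_sumr -big_split; apply: eq_bigr => k _ /=.
  by rewrite /P linf; ring.
by rewrite /P ling => gP; apply: (addrI (f h x * g x1)); rewrite gP /c; ring.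
Qed.

(** Homogenization: an extra coordinate [t], constrained to be nonnegative,
    multiplies the constants; its multiplier is [s]. *)
Lemma affine_farkas (E : lmodType R) (K : finType) (l : K -> E -> R)
    (b : K -> R) (g : E -> R) (c : R) :
  (forall k, scalar (l k)) -> scalar g ->
  (exists x, forall k, 0 <= l k x + b k) ->
  (forall x, (forall k, 0 <= l k x + b k) -> 0 <= g x + c) ->
  exists (s : R) (y : K -> R), [/\ 0 <= s, forall k, 0 <= y k
    & forall x, g x + c = s + \sum_k y k * (l k x + b k)].
Proof.
move=> linl ling [x0 lx0] g_ge0.
pose f (o : option K) (u : E * R^o) : R :=
  if o is Some k then l k u.1 + u.2 * b k else u.2.
pose h (u : E * R^o) : R := g u.1 + u.2 * c.
have linf o : scalar (f o).
  case: o => [k|] a u v //=; rewrite linl.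
  by rewrite /GRing.scale/=; ring.
have linh : scalar h.
  by move=> a u v; rewrite /h/= ling /GRing.scale/=; ring.
pose r := None :: [seq Some k | k <- index_enum K].
have uniq_r : uniq r.
  rewrite /= map_inj_uniq ?index_enum_uniq ?andbT; last by move=> ? ? [].
  by apply/mapP => -[].
have mem_r k : Some k \in r by rewrite inE map_f// mem_index_enum.
have [] := farkas uniq_r linf linh.
  move=> [x t] fxt.
  have t_ge0 : 0 <= t by apply: (fxt None); rewrite mem_head.
  have {}fxt k : 0 <= l k x + t * b k by exact: fxt _ (mem_r k).
  (* At [t = 0], [x] is a recession direction of the feasible set: [g] could
     not be negative there without [g + c] becoming negative far from [x0]. *)
  rewrite /h/=; move: t_ge0; rewrite le_eqVlt => /predU1P[t0|t_gt0].
    move: fxt; rewrite -t0 mul0r addr0 => fx.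
    rewrite leNgt; apply/negP => gx.
    (* The value of [g + c] at [s *: x + x0] is [-1]. *)
    pose s := (g x0 + c + 1) / - g x.
    have s_ge0 : 0 <= s.
      by rewrite divr_ge0 ?oppr_ge0 ?(ltW gx)// ltW// ltr_wpDl// g_ge0.
    have : 0 <= g (s *: x + x0) + c.
      apply: g_ge0 => k; rewrite linl -addrA addr_ge0// mulr_ge0//.
      by have := fx k; rewrite mul0r addr0.
    rewrite ling /s invrN mulrN mulNr divfK ?lt_eqF//; lra.
  have := g_ge0 (t^-1 *: x); rewrite scalar_homogeneous//.
  have -> : t^-1 * g x + c = t^-1 * (g x + t * c) by field; exact: lt0r_neq0.
  rewrite pmulr_rge0 ?invr_gt0//; apply => k; rewrite scalar_homogeneous//.
  have -> : t^-1 * l k x + b k = t^-1 * (l k x + t * b k) by field; exact: lt0r_neq0.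
  by rewrite mulr_ge0// invr_ge0 ltW.
move=> y [y_ge0 hE]; exists (y None), (y \o Some); split=> //= x.
have := hE (x, 1); rewrite /h/= mul1r => ->.
rewrite big_cons big_map /= mulr1.
by congr +%R; apply: eq_bigr => k _; rewrite mul1r.
Qed.
End Farkas.

(** * Nonnegative combinations of the slacks of the dispatch constraints *)

Section TruthfulBidding.
Context (R : realType) (I J L : finType) (M : market R I J L).
Implicit Types (x : dispatch R I J) (z : sw_dual R I J L).

Definition gen_reduced_cost z i : R :=
  - lambda z - mu_lo z i + mu_up z i
  - \sum_l gen_ptdf M i l * (chi_up z l - chi_lo z l).

Definition load_reduced_utility z j : R :=
  lambda z - phi_lo z j + phi_up z j
  + \sum_l load_ptdf M j l * (chi_up z l - chi_lo z l).

Definition sw_dual_nonneg z : Prop :=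
  [/\ forall i, 0 <= mu_lo z i /\ 0 <= mu_up z i,
      forall j, 0 <= phi_lo z j /\ 0 <= phi_up z j
    & forall l, 0 <= chi_lo z l /\ 0 <= chi_up z l].

Definition box_slack z x : R :=
  \sum_i (mu_lo z i * production x i + mu_up z i * (pmax M i - production x i))
  + \sum_j (phi_lo z j * consumption x j + phi_up z j * (dmax M j - consumption x j)).

(** In [sw_dual_feasible], [chi_up] enters with the sign of a multiplier of the
    lower line limit and [chi_lo] with that of the upper one; hence the pairing
    below. *)
Definition network_slack z x : R :=
  lambda z * imbalance x
  + \sum_l (chi_up z l * (capacity M l + flow M x l)
            + chi_lo z l * (capacity M l - flow M x l)).

Lemma sum_flow (w : L -> R) x :
  \sum_l w l * flow M x l =
  \sum_i (\sum_l w l * gen_ptdf M i l) * production x i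
  - \sum_j (\sum_l w l * load_ptdf M j l) * consumption x j.
Proof.
under eq_bigr do rewrite mulrBr !mulr_sumr.
rewrite sumrB; congr (_ - _); rewrite exchange_big; apply: eq_bigr => k _;
  by rewrite mulr_suml; apply: eq_bigr => l _; rewrite mulrA.
Qed.

(** Collecting the coefficients of each variable of the dispatch: dual
    feasibility of [z] amounts to nonnegativity together with this combination
    being the dual value minus the welfare, as [sw_dual_feasible_slack] and
    [slack_sw_dual_feasible] make precise. *)
Lemma weighted_slackE z x :
  box_slack z x + network_slack z x =
  sw_dual_value M z
  - (\sum_j load_reduced_utility z j * consumption x j
     + \sum_i gen_reduced_cost z i * production x i).
Proof.
rewrite /box_slack /network_slack /sw_dual_value /imbalance.
have -> : \sum_l (chi_up z l * (capacity M l + flow M x l)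
            + chi_lo z l * (capacity M l - flow M x l))
   = \sum_l (chi_up z l + chi_lo z l) * capacity M l
     + \sum_l (chi_up z l - chi_lo z l) * flow M x l.
  by rewrite -big_split; apply: eq_bigr => l _ /=; ring.
rewrite sum_flow.
have -> : \sum_j load_reduced_utility z j * consumption x j =
    lambda z * \sum_j consumption x j
    + \sum_j (phi_up z j - phi_lo z j) * consumption x j
    + \sum_j (\sum_l (chi_up z l - chi_lo z l) * load_ptdf M j l) * consumption x j.
  rewrite mulr_sumr -!big_split; apply: eq_bigr => j _ /=.
  rewrite /load_reduced_utility.
  under eq_bigr do rewrite mulrC.
  ring.
have -> : \sum_i gen_reduced_cost z i * production x i =
    \sum_i (mu_up z i - mu_lo z i) * production x i
    - lambda z * \sum_i production x i
    - \sum_i (\sum_l (chi_up z l - chi_lo z l) * gen_ptdf M i l) * production x i.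
  rewrite mulr_sumr -!sumrB; apply: eq_bigr => i _ /=.
  rewrite /gen_reduced_cost.
  under eq_bigr do rewrite mulrC.
  ring.
have -> : \sum_i (mu_lo z i * production x i + mu_up z i * (pmax M i - production x i))
   = \sum_i mu_up z i * pmax M i - \sum_i (mu_up z i - mu_lo z i) * production x i.
  by rewrite -sumrB; apply: eq_bigr => i _; ring.
have -> : \sum_j (phi_lo z j * consumption x j + phi_up z j * (dmax M j - consumption x j))
   = \sum_j phi_up z j * dmax M j - \sum_j (phi_up z j - phi_lo z j) * consumption x j.
  by rewrite -sumrB; apply: eq_bigr => i _; ring.
ring.
Qed.

Lemma box_slack_ge0 z x : sw_dual_nonneg z -> in_box M x -> 0 <= box_slack z x.
Proof.
move=> [mu_ge0 phi_ge0 _] [pbox dbox].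
rewrite addr_ge0// sumr_ge0// => k _.
  have [? ?] := mu_ge0 k; have /andP[? ?] := pbox k.
  by rewrite addr_ge0// mulr_ge0// subr_ge0.
have [? ?] := phi_ge0 k; have /andP[? ?] := dbox k.
by rewrite addr_ge0// mulr_ge0// subr_ge0.
Qed.

Lemma network_slack_ge0 z x :
  sw_dual_nonneg z -> in_network M x -> 0 <= network_slack z x.
Proof.
move=> [_ _ chi_ge0] [balx flowx].
rewrite /network_slack balx mulr0 add0r sumr_ge0// => l _.
have [? ?] := chi_ge0 l; have /andP[? ?] := flowx l.
by rewrite addr_ge0// mulr_ge0// ?subr_ge0// -lerBlDl sub0r.
Qed.

Lemma sw_dual_feasible_slack z x : sw_dual_feasible M z ->
  box_slack z x + network_slack z x = sw_dual_value M z - welfare M 1 x.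
Proof.
move=> [genE loadE _]; rewrite weighted_slackE /welfare.
congr (_ - _); congr (_ + _).
  by apply: eq_bigr => j _; rewrite [load_reduced_utility z j]loadE.
rewrite -sumrN; apply: eq_bigr => i _.
by rewrite [gen_reduced_cost z i]genE mul1r mulNr.
Qed.

Lemma weak_duality z x :
  sw_dual_feasible M z -> sw_feasible M x -> welfare M 1 x <= sw_dual_value M z.
Proof.
move=> feasz [boxx netx]; rewrite -subr_ge0 -sw_dual_feasible_slack//.
have [_ _ ?] := feasz.
by rewrite addr_ge0 ?box_slack_ge0 ?network_slack_ge0.
Qed.

Lemma sum_delta (K : finType) (a : K -> R) (k : K) :
  \sum_i a i * [ffun j => (j == k)%:R : R] i = a k.
Proof.
rewrite (bigD1 k)//= ffunE eqxx mulr1 big1 ?addr0// => i /negPf ik.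
by rewrite ffunE ik mulr0.
Qed.

Lemma sum_zero (K : finType) (a : K -> R) :
  \sum_i a i * [ffun=> 0 : R] i = 0.
Proof. by rewrite big1// => i _; rewrite ffunE mulr0. Qed.

(** The coefficients of an affine function of the dispatch are read off at the
    zero dispatch and at the unit dispatches. *)
Lemma slack_sw_dual_feasible z (s o : R) : sw_dual_nonneg z ->
  (forall x, o - welfare M 1 x = s + (box_slack z x + network_slack z x)) ->
  sw_dual_feasible M z /\ o = s + sw_dual_value M z.
Proof.
move=> z_ge0 slackE.
pose x0 : dispatch R I J := Dispatch [ffun=> 0] [ffun=> 0].
have oE : o = s + sw_dual_value M z.
  have := slackE x0.
  by rewrite weighted_slackE /welfare !sum_zero addr0 !subr0.
split=> //; split=> // [i|j].
  have := slackE (Dispatch [ffun k => (k == i)%:R] [ffun=> 0]).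
  rewrite weighted_slackE oE /welfare !sum_zero !sum_delta mul1r.
  rewrite /gen_reduced_cost; lra.
have := slackE (Dispatch [ffun=> 0] [ffun k => (k == j)%:R]).
rewrite weighted_slackE oE /welfare !sum_zero !sum_delta.
rewrite /load_reduced_utility; lra.
Qed.

(** * Farkas certificates on the space of dispatches *)

(** Dispatches form a record without vector space structure; linearity is that
    of the function on the product of the two coordinate spaces. *)
Definition linear_in_dispatch (f : dispatch R I J -> R) : Prop :=
  scalar (fun u : {ffun I -> R^o} * {ffun J -> R^o} => f (Dispatch u.1 u.2)).

Lemma scalar_sum_coef (K : finType) (a : K -> R) :
  scalar (fun u : {ffun K -> R^o} => \sum_k a k * u k).
Proof.
move=> c u v; rewrite mulr_sumr -big_split; apply: eq_bigr => k _ /=.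
by rewrite !ffunE /GRing.scale/=; ring.
Qed.

Lemma linear_coef (a : I -> R) (b : J -> R) :
  linear_in_dispatch
    (fun x => \sum_i a i * production x i - \sum_j b j * consumption x j).
Proof.
move=> c u v /=.
rewrite (scalar_sum_coef a c u.1 v.1) (scalar_sum_coef b c u.2 v.2); ring.
Qed.

Lemma linearN_in_dispatch f :
  linear_in_dispatch f -> linear_in_dispatch (fun x => - f x).
Proof. by move=> linf c u v; rewrite linf; ring. Qed.

Lemma linear_imbalance : linear_in_dispatch (@imbalance R I J).
Proof.
have imbalanceE x : imbalance x =
    \sum_i 1 * production x i - \sum_j 1 * consumption x j.
  by congr (_ - _); apply: eq_bigr => k _; rewrite mul1r.
by move=> c u v; rewrite !imbalanceE; exact: linear_coef.
Qed.

Lemma linear_production i :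
  linear_in_dispatch (fun x => production x i).
Proof.
by move=> c u v; change ((c *: u.1 + v.1) i = c * u.1 i + v.1 i); rewrite !ffunE.
Qed.

Lemma linear_consumption j :
  linear_in_dispatch (fun x => consumption x j).
Proof.
by move=> c u v; change ((c *: u.2 + v.2) j = c * u.2 j + v.2 j); rewrite !ffunE.
Qed.

Lemma linear_flow l : linear_in_dispatch ((flow M)^~ l).
Proof. exact: linear_coef. Qed.

Lemma linear_welfare r : linear_in_dispatch (welfare M r).
Proof.
move=> c u v.
have := linearN_in_dispatch (linear_coef
  (fun i => cost M i + r * kappa M * emission M i) (utility M)) c u v.
by rewrite !opprB.
Qed.

(** Farkas' lemma for dispatches, with one additional affine constraint [g + b].
    The balance equation counts as two inequalities, whose multipliers are
    subtracted to give [lambda z]. *)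
Lemma slack_certificate (f g : dispatch R I J -> R) (a b : R) :
  linear_in_dispatch f -> linear_in_dispatch g ->
  (exists x, sw_feasible M x /\ 0 <= g x + b) ->
  (forall x, sw_feasible M x -> 0 <= g x + b -> 0 <= f x + a) ->
  exists (s e : R) z, [/\ 0 <= s, 0 <= e, sw_dual_nonneg z
    & forall x, f x + a = s + (box_slack z x + network_slack z x) + e * (g x + b)].
Proof.
move=> linf ling [x0 [feasx0 gx0]] f_ge0.
pose K : finType := ((unit + bool) + ((I + I) + (J + J)) + (L + L))%type.
pose l (k : K) (x : dispatch R I J) : R := match k with
  | inl (inl (inl _)) => g x
  | inl (inl (inr false)) => imbalance x
  | inl (inl (inr true)) => - imbalance x
  | inl (inr (inl (inl i))) => production x i
  | inl (inr (inl (inr i))) => - production x i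
  | inl (inr (inr (inl j))) => consumption x j
  | inl (inr (inr (inr j))) => - consumption x j
  | inr (inl l) => flow M x l
  | inr (inr l) => - flow M x l
  end.
pose c (k : K) : R := match k with
  | inl (inl (inl _)) => b
  | inl (inl (inr _)) => 0
  | inl (inr (inl (inl _))) => 0
  | inl (inr (inl (inr i))) => pmax M i
  | inl (inr (inr (inl _))) => 0
  | inl (inr (inr (inr j))) => dmax M j
  | inr (inl l) => capacity M l
  | inr (inr l) => capacity M l
  end.
have linl k : linear_in_dispatch (l k).
  move: k => [[[_|[]]|[[i|i]|[j|j]]]|[k|k]] //=.
  - exact: linearN_in_dispatch linear_imbalance.
  - exact: linear_imbalance.
  - exact: linear_production.
  - exact: linearN_in_dispatch (linear_production _).
  - exact: linear_consumption.
  - exact: linearN_in_dispatch (linear_consumption _).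
  - exact: linear_flow.
  - exact: linearN_in_dispatch (linear_flow _).
have lP x : (forall k, 0 <= l k x + c k) <-> sw_feasible M x /\ 0 <= g x + b.
  split=> [lx|[[[pbox dbox] [balx flowx]] gx]].
    split; last exact: (lx (inl (inl (inl tt)))).
    split; split; [move=> k|move=> k| |move=> k].
    - have := lx (inl (inr (inl (inl k)))); have := lx (inl (inr (inl (inr k)))).
      by rewrite /l/c; lra.
    - have := lx (inl (inr (inr (inl k)))); have := lx (inl (inr (inr (inr k)))).
      by rewrite /l/c; lra.
    - have := lx (inl (inl (inr true))); have := lx (inl (inl (inr false))).
      by rewrite /l/c; lra.
    - have := lx (inr (inl k)); have := lx (inr (inr k)).
      by rewrite /l/c; lra.
  move=> [[[_|[]]|[[i|i]|[j|j]]]|[k|k]] //=; rewrite ?balx; try lra.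
  - by have := pbox i; lra.
  - by have := pbox i; lra.
  - by have := dbox j; lra.
  - by have := dbox j; lra.
  - by have := flowx k; lra.
  - by have := flowx k; lra.
have [|u|s [y [s_ge0 y_ge0 fE]]] := affine_farkas (b := c) (c := a) linl linf.
- exists (production x0, consumption x0) => k; case: x0 feasx0 gx0 => p d feas g0.
  exact: (lP _).2.
- by move=> /lP[] feasu gu; exact: f_ge0.
pose z : sw_dual R I J L := SwDual
  (y (inl (inl (inr false))) - y (inl (inl (inr true))))
  [ffun i => y (inl (inr (inl (inl i))))] [ffun i => y (inl (inr (inl (inr i))))]
  [ffun j => y (inl (inr (inr (inl j))))] [ffun j => y (inl (inr (inr (inr j))))]
  [ffun l => y (inr (inr l))] [ffun l => y (inr (inl l))].
exists s, (y (inl (inl (inl tt)))), z; split=> //.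
  by split=> k; rewrite !ffunE.
case=> p d; have /= -> := fE (p, d); rewrite -addrA; congr (s + _).
rewrite !big_sumType big_bool (bigD1 tt)//= big1 ?addr0; last by case.
rewrite /box_slack /network_slack !big_split /=.
have sumE (T : finType) (w h h' : T -> R) : h =1 h' ->
    \sum_t w t * h t = \sum_t [ffun t => w t] t * h' t.
  by move=> hh'; apply: eq_bigr => t _; rewrite ffunE hh'.
rewrite (sumE _ _ (fun i => p i + 0) p); last by move=> i; rewrite addr0.
rewrite (sumE _ _ (fun i => - p i + pmax M i) (fun i => pmax M i - p i));
  last by move=> i; rewrite addrC.
rewrite (sumE _ _ (fun j => d j + 0) d); last by move=> j; rewrite addr0.
rewrite (sumE _ _ (fun j => - d j + dmax M j) (fun j => dmax M j - d j));
  last by move=> j; rewrite addrC.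
pose phi := flow M (Dispatch p d).
rewrite (sumE _ _ (fun l => phi l + capacity M l) (fun l => capacity M l + phi l));
  last by move=> k; rewrite addrC.
rewrite (sumE _ _ (fun l => - phi l + capacity M l) (fun l => capacity M l - phi l));
  last by move=> k; rewrite addrC.
rewrite /phi; ring.
Qed.

(** * Strong duality for market clearing *)

(** The prices are the coefficients with which the Lagrangian charges or rewards
    each unit beyond the agent's own cost or utility. *)
Lemma lagrangianE delta (y : multipliers R L) x z :
  lagrangian M delta y x z =
  \sum_i gen_profit M delta y i (production x i)
  + \sum_j load_payoff M y j (consumption x j)
  + (\sum_l (alpha_lo y l + alpha_up y l) * capacity M l
     - eta y * sw_dual_value M z).
Proof.
pose w l := alpha_lo y l - alpha_up y l.
have limitE : \sum_l alpha_lo y l * (capacity M l + flow M x l)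
      + \sum_l alpha_up y l * (capacity M l - flow M x l)
    = \sum_l (alpha_lo y l + alpha_up y l) * capacity M l
      + \sum_l w l * flow M x l.
  by rewrite -!big_split; apply: eq_bigr => l _ /=; rewrite /w; ring.
rewrite /lagrangian -[X in X + eta y * _]addrA limitE sum_flow.
have -> : \sum_i gen_profit M delta y i (production x i) =
    tau y * (\sum_i production x i)
    + \sum_i (\sum_l w l * gen_ptdf M i l) * production x i
    - \sum_i (cost M i + delta * kappa M * emission M i) * production x i
    - eta y * \sum_i (cost M i + 1 * kappa M * emission M i) * production x i.
  rewrite !mulr_sumr -big_split -!sumrB; apply: eq_bigr => i _ /=.
  by rewrite /gen_profit /gen_price -/w; ring.
have -> : \sum_j load_payoff M y j (consumption x j) =
    \sum_j utility M j * consumption x j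
    + eta y * (\sum_j utility M j * consumption x j)
    - tau y * (\sum_j consumption x j)
    - \sum_j (\sum_l w l * load_ptdf M j l) * consumption x j.
  rewrite !mulr_sumr -big_split -!sumrB; apply: eq_bigr => j _ /=.
  by rewrite /load_payoff /load_price -/w; ring.
rewrite /welfare /imbalance; ring.
Qed.

(** The additional constraint is taken trivial.  Comparing coefficients turns the
    certificate that no welfare exceeds that of [x] into dual feasibility of its
    multipliers, and the constant [s >= 0] of the certificate is the amount by
    which their value stays below that welfare. *)
Lemma sw_dual_attained x : sw_optimal M x ->
  exists z, sw_dual_feasible M z /\ sw_dual_value M z <= welfare M 1 x.
Proof.
move=> [feasx optx].
have lin0 : linear_in_dispatch (fun=> 0) by move=> c u v; rewrite mulr0 addr0.
have [||s [e [z [s_ge0 _ z_ge0 slackE]]]] := slack_certificate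
  (a := welfare M 1 x) (b := 0) (linearN_in_dispatch (linear_welfare 1)) lin0.
- by exists x; rewrite addr0.
- by move=> t feast _; rewrite addrC subr_ge0 optx.
have [|feasz ->] := slack_sw_dual_feasible z_ge0 (s := s) (o := welfare M 1 x).
  by move=> t; have := slackE t; lra.
by exists z; rewrite lerDr.
Qed.

(** By uniqueness, the constraint that [welfare 1] be at least that of [x]
    leaves only [x], where [welfare delta] is trivially maximal; its multiplier
    is [eta].  The box slacks are dropped because the Lagrangian keeps the box
    as an explicit constraint. *)
Lemma lagrangian_bound_attained delta x :
  unique (sw_optimal M) x ->
  exists y, multipliers_feasible y /\
    (dual_function M delta y <= (welfare M delta x)%:E)%E.
Proof.
move=> [optx uniqx]; have [feasx maxx] := optx.
have [||s [e [z [s_ge0 e_ge0 z_ge0 slackE]]]] := slack_certificate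
  (a := welfare M delta x) (b := - welfare M 1 x)
  (linearN_in_dispatch (linear_welfare delta)) (linear_welfare 1).
- by exists x; rewrite subrr.
- move=> t feast; rewrite subr_ge0 => le_xt.
  rewrite -(uniqx t) ?addNr//; split=> // u feasu.
  exact: le_trans (maxx u feasu) le_xt.
have [_ _ chi_ge0] := z_ge0.
exists (Multipliers (lambda z) (chi_up z) (chi_lo z) e); split.
  by split=> // l; have [] := chi_ge0 l.
apply: ge_ereal_sup => _ [t [z' [boxt feasz' ->]]]; rewrite lee_fin.
have gapz' : e * (welfare M 1 x - sw_dual_value M z') <= 0.
  by rewrite mulr_ge0_le0// subr_le0 weak_duality.
have := slackE t; have := box_slack_ge0 z_ge0 boxt.
rewrite /lagrangian /= /network_slack big_split /=; lra.
Qed.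

(** With a dual solution [z] without duality gap, every term added to the welfare
    in the Lagrangian at [(x, z)] is nonnegative, so the Lagrangian reaches there
    its bound [welfare delta x]. *)
Lemma lagrangian_maximizer delta y x :
  unique (sw_optimal M) x -> dual_optimal M delta y ->
  exists z, forall t, in_box M t -> lagrangian M delta y t z <= lagrangian M delta y x z.
Proof.
move=> uniqx [feasy miny]; have [optx _] := uniqx.
have [z [feasz gapz]] := sw_dual_attained optx.
have [y' [feasy' boundy']] := lagrangian_bound_attained delta uniqx.
exists z => t boxt; apply: (@le_trans _ _ (welfare M delta x)).
  rewrite -lee_fin (le_trans _ boundy')// (le_trans _ (miny _ feasy'))//.
  by apply: ereal_sup_ubound; exists t, z.
have [[boxx [balx flowx]] _] := optx.
have [alo_ge0 aup_ge0 eta_ge0] := feasy.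
rewrite /lagrangian balx mulr0 addr0; apply: ler_wpDr;
  last apply: ler_wpDr; last apply: ler_wpDr => //.
- by rewrite mulr_ge0// subr_ge0.
- by rewrite sumr_ge0// => l _; have /andP[_ ?] := flowx l; rewrite mulr_ge0// subr_ge0.
- rewrite sumr_ge0// => l _; have /andP[? _] := flowx l.
  by rewrite mulr_ge0// -lerBlDl sub0r.
Qed.

(** * Price-taking agents *)

Lemma separable_le_coord (K : finType) (F : K -> R -> R) (p : {ffun K -> R}) k q :
  \sum_i F i ([ffun i => if i == k then q else p i] i) <= \sum_i F i (p i) ->
  F k q <= F k (p k).
Proof.
rewrite (bigD1 k)//= [leRHS](bigD1 k)//= ffunE eqxx.
by rewrite (eq_bigr (fun i => F i (p i))) ?lerD2r// => i /negPf ik; rewrite ffunE ik.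
Qed.

Lemma gen_profit_max delta y x i q :
  unique (sw_optimal M) x ->
  dual_optimal M delta y -> 0 <= q <= pmax M i ->
  gen_profit M delta y i q <= gen_profit M delta y i (production x i).
Proof.
move=> uniqx opty boxq; have [[[[pbox dbox] _] _] _] := uniqx.
have [z maxz] := lagrangian_maximizer uniqx opty.
have := maxz (Dispatch [ffun k => if k == i then q else production x k] (consumption x)).
rewrite !lagrangianE !lerD2r => le_sum; apply: separable_le_coord; apply: le_sum.
by split=> // k /=; rewrite ffunE; case: eqP => [->|].
Qed.

Lemma load_payoff_max delta y x j q :
  unique (sw_optimal M) x ->
  dual_optimal M delta y -> 0 <= q <= dmax M j ->
  load_payoff M y j q <= load_payoff M y j (consumption x j).
Proof.
move=> uniqx opty boxq; have [[[[pbox dbox] _] _] _] := uniqx.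
have [z maxz] := lagrangian_maximizer uniqx opty.
have := maxz (Dispatch (production x) [ffun k => if k == j then q else consumption x k]).
rewrite !lagrangianE lerD2r lerD2l => le_sum; apply: separable_le_coord; apply: le_sum.
by split=> // k /=; rewrite ffunE; case: eqP => [->|].
Qed.

Lemma eta_with_id (K : finType) (f : K -> R) k : ([eta f with k |-> f k] : K -> R) = f.
Proof. by apply/funext => i /=; case: eqP => [->|]. Qed.

Lemma set_true_gen_bid i : set_gen_bid M i (true_gen_bid M i) = M.
Proof. by rewrite /set_gen_bid !eta_with_id; case: M. Qed.

Lemma set_true_load_bid j : set_load_bid M j (true_load_bid M j) = M.
Proof. by rewrite /set_load_bid !eta_with_id; case: M. Qed.

End TruthfulBidding.

Theorem proposition4 (R : realType) (I J L : finType) (M : market R I J L)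
    (delta : R) (y : multipliers R L)
    (validM : valid_market M) (delta01 : 0 <= delta <= 1)
    (sw_unique : exists! x : dispatch R I J, sw_optimal M x)
    (y_pricing : pricing_multipliers M delta y) :
  (forall (i : I) (X : gen_bid R -> dispatch R I J),
     gen_response M i X ->
     is_maximizer
       (fun t : gen_bid R => 0 <= bid_pmax t /\ 0 <= production (X t) i <= pmax M i)
       (fun t : gen_bid R => gen_profit M delta y i (production (X t) i))
       (true_gen_bid M i)) /\
  (forall (j : J) (X : load_bid R -> dispatch R I J),
     load_response M j X ->
     is_maximizer
       (fun t : load_bid R => 0 <= bid_dmax t /\ 0 <= consumption (X t) j <= dmax M j)
       (fun t : load_bid R => load_payoff M y j (consumption (X t) j))
       (true_load_bid M j)).
Proof.
have [_ pmax_ge0 dmax_ge0 _ _] := validM.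
have [x uniqx] := sw_unique; have [[[[pbox dbox] _] _] x_eq] := uniqx.
have [opty _] := y_pricing.
split=> [i|j] X respX.
  have Xtrue : X (true_gen_bid M i) = x.
    apply/esym/x_eq.
    by have := respX (true_gen_bid M i) (pmax_ge0 i); rewrite set_true_gen_bid.
  rewrite /is_maximizer Xtrue; split=> [|t [_ boxt]].
    by split; [exact: pmax_ge0 | exact: pbox].
  exact: (gen_profit_max uniqx opty boxt).
have Xtrue : X (true_load_bid M j) = x.
  apply/esym/x_eq.
  by have := respX (true_load_bid M j) (dmax_ge0 j); rewrite set_true_load_bid.
rewrite /is_maximizer Xtrue; split=> [|t [_ boxt]].
  by split; [exact: dmax_ge0 | exact: dbox].
exact: (load_payoff_max uniqx opty boxt).
Qed.
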